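(* Let $n\ge 1$, $\hbar>0$, and let $\theta=(\theta^{ij})$ be a constant real antisymmetric $n\times n$ matrix. For two proper functions $A(x,p)$ on $\mathbb{R}^n\times\mathbb{R}^n$ and $B(x)$ on $\mathbb{R}^n$, the following equality holds: $$\int d^n y\,\Big\{ A(x,p) * B(x) * e^{i y\cdot p}\Big\} \;=\; \int d^n y\,\big\{A(x,-i\hbar\,\tfrac{\partial}{\partial x}) *_{\theta} B(x)\big\} * e^{i y\cdot p},$$ where $\frac{\partial}{\partial x}$ is a differential operator, Weyl-ordered with respect to $x$, which acts on the $x$-dependencies of both $A$ and $B$; the curly bracket on the right-hand side signifies that the differential operator does not act on $x$-dependent functions, if any, outside the bracket.
   Context: ''Proper functions'' carries no further specification: no particular function class is fixed. The functions are those for which the Fourier representations, star products and integrals written here are meaningful, and the identity is a formal one obtained by Fourier superposition of exponentials. Notation: $k\cdot x=\sum_i k_i x^i$ and $\theta(k,k')=\sum_{i,j}\theta^{ij}k_ik'_j$. For $A$ on $\mathbb{R}^{2n}$, $\tilde A(k,l)=\int d^nx\,d^np\, e^{-ik\cdot x-il\cdot p}A(x,p)$; for $B$ on $\mathbb{R}^n$, $\tilde B(k)=\int d^nx\, e^{-ik\cdot x}B(x)$. Star product: $$A(x,p)*C(x,p)=\exp\Big\{\tfrac{i\hbar}{2}\big(\partial_{x}\cdot\partial_{p'}-\partial_{x'}\cdot\partial_{p}\big)+\tfrac{i}{2}\theta^{ij}\partial_{x^i}\partial_{x'^j}\Big\}A(x,p)\,C(x',p')\Big|_{x'=x,\,p'=p},$$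 equivalently, on exponentials $$e^{ik\cdot x+il\cdot p} * e^{ik'\cdot x+il'\cdot p}=e^{-\frac{i\hbar}{2}(k\cdot l'-k'\cdot l)}\,e^{-\frac{i}{2}\theta(k,k')}\,e^{i(k+k')\cdot x+i(l+l')\cdot p},$$ extended bilinearly by Fourier superposition; the product is associative. In particular, for $y\in\mathbb{R}^n$, $C*e^{iy\cdot p}=e^{iy\cdot p}\,C(x-\tfrac{\hbar}{2}y,p)$ (also when $C$ depends on $x$ only). The product $*_\theta$ is obtained from $*$ by setting $\hbar=0$. Weyl-ordered operator: $$A(x,-i\hbar\tfrac{\partial}{\partial x})*_\theta B(x)=\frac{1}{(2\pi)^{3n}}\int \tilde A(k,l)\tilde B(k')\,\big\{e^{ik\cdot x+il\cdot(-i\hbar\partial_x)}*_\theta e^{ik'\cdot x}\big\}\,d^nk\,d^nl\,d^nk',$$ where $e^{ik\cdot x+\hbar l\cdot\partial_x}=e^{ik\cdot x}e^{\frac{i\hbar}{2}k\cdot l}e^{\hbar l\cdot\partial_x}$, so that $$e^{ik\cdot x+il\cdot(-i\hbar\partial_x)}*_\theta e^{ik'\cdot x}=e^{i\hbar\, l\cdot(k'+\frac12 k)}\,e^{-\frac i2\theta(k,k')}\,e^{i(k+k')\cdot x}.$$ *)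

(* Defs.v *)
From HB Require Import structures.
From mathcomp Require Import all_boot all_order all_algebra.
From mathcomp Require Import complex.
From mathcomp Require Import all_classical all_reals all_analysis.

Set Implicit Arguments.
Unset Strict Implicit.
Unset Printing Implicit Defensive.

Import Order.TTheory GRing.Theory Num.Theory.
Import numFieldNormedType.Exports.

Local Open Scope classical_set_scope.
Local Open Scope ring_scope.
Local Open Scope complex_scope.

(* The product of sigma-finite measures as a sigma-finite measure: the library
   proves it, but its canonical sigma-finite structure on [m1 \x m2] is only
   inferred for subprobabilities, which forbids iterated products. *)
Section sigma_finite_product.
Context d1 d2 (T1 : measurableType d1) (T2 : measurableType d2) (R : realType).
Context (m1 : {sigma_finite_measure set T1 -> \bar R}).
Context (m2 : {sigma_finite_measure set T2 -> \bar R}).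

Definition sprod : set (T1 * T2) -> \bar R := (m1 \x m2)%E.

HB.instance Definition _ := Measure.on sprod.

Let sprod_sigma_finite : sigma_finite setT sprod.
Proof.
have [F FT Foo] := sigma_finiteT m1.
have [G GT Goo] := sigma_finiteT m2.
pose H k := if @unpickle (nat * nat)%type k is Some (i, j) then F i `*` G j
  else set0.
exists H.
  apply/esym; rewrite -subTset => -[x y] _.
  have : [set: T1] x by []. rewrite FT => -[i _ Fx].
  have : [set: T2] y by []. rewrite GT => -[j _ Gy].
  by exists (pickle (i, j)) => //; rewrite /H pickleK.
move=> k; rewrite /H; case: unpickle => [[i j]|]; last by rewrite measure0.
have [mF Fi] := Foo i; have [mG Gj] := Goo j; split; first exact: measurableX.
by rewrite /sprod product_measure1E// lte_mul_pinfty// ge0_fin_numE.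
Qed.

HB.instance Definition _ := Measure_isSigmaFinite.Build _ _ _ sprod
  sprod_sigma_finite.

End sigma_finite_product.

(* R^n is 'rV[R]_n.  The library has no sigma-algebra and no Lebesgue measure
   on it: the former is the one generated by the coordinates, the latter the
   n-fold product of the Lebesgue measure of R. *)

Definition rV_display : measure_display. Proof. exact. Qed.

Section rV_measurable.
Context (R : realType) (n : nat).

Definition coordinate (i : 'I_n) (x : 'rV[R]_n) : measurableTypeR R := x ord0 i.

Let rV_set0 : g_sigma_preimage coordinate set0.
Proof. exact: sigma_algebra0. Qed.

Let rV_setC A :
  g_sigma_preimage coordinate A -> g_sigma_preimage coordinate (~` A).
Proof. exact: sigma_algebraC. Qed.

Let rV_bigcup (F : _^nat) : (forall i, g_sigma_preimage coordinate (F i)) ->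
  g_sigma_preimage coordinate (\bigcup_i (F i)).
Proof. exact: sigma_algebra_bigcup. Qed.

HB.instance Definition _ := @isMeasurable.Build rV_display
  'rV[R]_n (g_sigma_preimage coordinate) rV_set0 rV_setC rV_bigcup.

Lemma measurable_coordinate (i : 'I_n) :
  measurable_fun [set: 'rV[R]_n] (coordinate i).
Proof.
move=> _ Y mY; rewrite setTI; apply: sub_sigma_algebra => /=.
rewrite -bigcup_seq/=; exists i => /=; first by rewrite mem_index_enum.
by exists Y => //; rewrite setTI.
Qed.

Lemma measurable_rVP d (T : measurableType d) (f : T -> 'rV[R]_n) :
  (forall i, measurable_fun [set: T] (coordinate i \o f)) ->
  measurable_fun [set: T] f.
Proof.
move=> mf.
suff H : preimage_set_system setT f (g_sigma_preimage coordinate) `<=` measurable.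
  by move=> _ A mA; apply: H; exists A.
rewrite -g_sigma_preimage_comp; apply: smallest_sub.
  exact: sigma_algebra_measurable.
by rewrite -bigcup_seq; apply: bigcup_sub => i _ A [B mB <-]; exact: mf.
Qed.

End rV_measurable.

Section rV_lebesgue.
Context (R : realType).

Definition rV_cons (n : nat) (z : measurableTypeR R * 'rV[R]_n) : 'rV[R]_n.+1 :=
  \row_i oapp (fun j => coordinate j z.2) z.1 (unlift ord0 i).

Lemma measurable_rV_cons (n : nat) :
  measurable_fun [set: measurableTypeR R * 'rV[R]_n] (@rV_cons n).
Proof.
apply: measurable_rVP => i.
rewrite (_ : _ \o _ = fun z => oapp (fun j => coordinate j z.2) z.1 (unlift ord0 i)).
  case: (unlift ord0 i) => [j|] /=; last exact: measurable_fst.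
  exact: (measurableT_comp (measurable_coordinate j) measurable_snd).
by apply/funext => z; rewrite /= /coordinate mxE.
Qed.

Section step.
Context (n : nat) (mu : {sigma_finite_measure set 'rV[R]_n -> \bar R}).

Definition rV_cons_measure : set 'rV[R]_n.+1 -> \bar R :=
  pushforward (sprod (@lebesgue_measure R) mu) (@rV_cons n).

Let cons_measure0 : rV_cons_measure set0 = 0%E.
Proof. by rewrite /rV_cons_measure /pushforward preimage_set0 measure0. Qed.

Let mpre A : measurable A -> measurable (@rV_cons n @^-1` A).
Proof.
by move=> mA; rewrite -[X in measurable X]setTI; exact: measurable_rV_cons.
Qed.

Let cons_measure_ge0 A : (0 <= rV_cons_measure A)%E.
Proof. by rewrite /rV_cons_measure /pushforward measure_ge0. Qed.

Let cons_measure_sigma_additive : semi_sigma_additive rV_cons_measure.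
Proof.
move=> F mF tF mUF; rewrite /rV_cons_measure /pushforward preimage_bigcup.
apply: measure_semi_sigma_additive.
- by move=> k; exact: mpre.
- apply/trivIsetP => i j _ _ ij; rewrite -preimage_setI.
  by move/trivIsetP : tF => /(_ _ _ _ _ ij) ->//; rewrite preimage_set0.
- by rewrite -preimage_bigcup; exact: mpre.
Qed.

HB.instance Definition _ := isMeasure.Build _ _ _ rV_cons_measure
  cons_measure0 cons_measure_ge0 cons_measure_sigma_additive.

Let rV_split (x : 'rV[R]_n.+1) : measurableTypeR R * 'rV[R]_n :=
  (coordinate ord0 x, \row_j coordinate (lift ord0 j) x).

Let rV_consK : cancel (@rV_cons n) rV_split.
Proof.
move=> [t v]; congr pair; first by rewrite /coordinate mxE unlift_none.
by apply/rowP => j; rewrite mxE /coordinate mxE liftK.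
Qed.

Let measurable_rV_split : measurable_fun setT rV_split.
Proof.
apply/measurable_fun_pair => /=; first exact: measurable_coordinate.
apply: measurable_rVP => j.
rewrite (_ : _ \o _ = coordinate (lift ord0 j)).
  exact: measurable_coordinate.
by apply/funext => x; rewrite /= /coordinate mxE.
Qed.

Let cons_measure_sigma_finite : sigma_finite setT rV_cons_measure.
Proof.
have [F FT Foo] := sigma_finiteT (sprod (@lebesgue_measure R) mu).
exists (fun k => rV_split @^-1` F k); first by rewrite -preimage_bigcup -FT.
move=> k; have [mFk Fkoo] := Foo k; split.
  by rewrite -[X in measurable X]setTI; exact: measurable_rV_split.
rewrite /rV_cons_measure /pushforward -comp_preimage.
by rewrite (_ : _ \o _ = id)//; apply/funext => z; exact: rV_consK.
Qed.

HB.instance Definition _ := Measure_isSigmaFinite.Build _ _ _ rV_cons_measure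
  cons_measure_sigma_finite.

End step.

Fixpoint lebesgue_rV (n : nat) :
    {sigma_finite_measure set 'rV[R]_n -> \bar R} :=
  if n is m.+1 then rV_cons_measure (lebesgue_rV m) else \d_(0 : 'rV[R]_0).

End rV_lebesgue.

Arguments lebesgue_rV {R} n.

Section complex_integral.
Context d (T : measurableType d) (R : realType).
Variable mu : {measure set T -> \bar R}.

Definition cintegrable (f : T -> R[i]) : Prop :=
  mu.-integrable setT (EFin \o (@complex.Re R \o f)) /\
  mu.-integrable setT (EFin \o (@complex.Im R \o f)).

(* Only meaningful for [cintegrable] functions. *)
Definition cintegral (f : T -> R[i]) : R[i] :=
  (\int[mu]_t complex.Re (f t)) +i* (\int[mu]_t complex.Im (f t)).

End complex_integral.

Section star_product.
Context (R : realType) (n : nat).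
Local Notation V := 'rV[R]_n.
Local Notation C := R[i].
Local Notation leb := (@lebesgue_rV R n).

Definition expi (t : R) : C := cos t +i* sin t.

Definition dot (k x : V) : R := \sum_i k ord0 i * x ord0 i.

Definition theta_form (theta : 'M[R]_n) (k k' : V) : R :=
  \sum_i \sum_j theta i j * k ord0 i * k' ord0 j.

Definition wave (k l x p : V) : C := expi (dot k x + dot l p).

Definition of_position (f : V -> C) : V -> V -> C := fun x _ => f x.

(* A Fourier superposition of exponentials: plane waves integrated against the
   complex measure [amplitude . weight], indexed by an arbitrary sigma-finite
   space.  Taking complex measures and not only Lebesgue densities makes
   functions of x alone and the exponentials themselves superpositions. *)
Record superposition := Superposition {
  mode_display : measure_display;
  mode : measurableType mode_display;
  weight : {sigma_finite_measure set mode -> \bar R};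
  amplitude : mode -> C;
  xfreq : mode -> V;
  pfreq : mode -> V;
  amplitude_integrable : cintegrable weight amplitude;
  measurable_xfreq : measurable_fun setT xfreq;
  measurable_pfreq : measurable_fun setT pfreq }.

Definition superpose (S : superposition) (x p : V) : C :=
  cintegral (weight S) (fun s => amplitude s * wave (xfreq s) (pfreq s) x p).

Definition wave_cocycle (hbar : R) (theta : 'M[R]_n) (k l k' l' : V) : C :=
  expi (- (hbar / 2) * (dot k l' - dot k' l)) *
  expi (- theta_form theta k k' / 2).

Definition star_wave (hbar : R) (theta : 'M[R]_n) (k l k' l' x p : V) : C :=
  wave_cocycle hbar theta k l k' l' * wave (k + k') (l + l') x p.

Definition star_superposition (hbar : R) (theta : 'M[R]_n)
    (S S' : superposition) (x p : V) : C :=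
  cintegral (sprod (weight S) (weight S')) (fun s =>
    amplitude s.1 * amplitude s.2 *
    star_wave hbar theta (xfreq s.1) (pfreq s.1) (xfreq s.2) (pfreq s.2) x p).

(* The value does not depend on the superpositions chosen for F and G: by Fubini
   it can be computed from G and any superposition giving F, and from F and any
   superposition giving G.  It is 0 if F or G is not a superposition. *)
Definition star (hbar : R) (theta : 'M[R]_n) (F G : V -> V -> C) (x p : V) : C :=
  xget 0 [set z | exists S S' : superposition,
    [/\ superpose S = F, superpose S' = G &
        z = star_superposition hbar theta S S' x p]].

Definition star_theta (theta : 'M[R]_n) : (V -> V -> C) -> (V -> V -> C) ->
  V -> V -> C := star 0 theta.

Definition fourier_xp (A : V -> V -> C) (k l : V) : C :=
  cintegral (sprod leb leb)
    (fun z => expi (- dot k z.1 - dot l z.2) * A z.1 z.2).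

Definition fourier_x (B : V -> C) (k : V) : C :=
  cintegral leb (fun x => expi (- dot k x) * B x).

(* The functions whose Fourier transform and Fourier representation are
   absolutely convergent integrals. *)
Definition proper_xp (A : V -> V -> C) : Prop :=
  [/\ cintegrable (sprod leb leb) (fun z => A z.1 z.2),
      cintegrable (sprod leb leb) (fun z => fourier_xp A z.1 z.2) &
      forall x p, A x p = ((2 * pi) ^- (2 * n))%:C *
        cintegral (sprod leb leb)
          (fun z => fourier_xp A z.1 z.2 * wave z.1 z.2 x p)].

Definition proper_x (B : V -> C) : Prop :=
  [/\ cintegrable leb B, cintegrable leb (fourier_x B) &
      forall x, B x = ((2 * pi) ^- n)%:C *
        cintegral leb (fun k => fourier_x B k * expi (dot k x))].

(* {e^{i k.x + i l.(-i hbar d/dx)} *_theta f}(x), where the operator is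
   e^{i k.x} e^{(i hbar/2) k.l} e^{hbar l.d/dx} and e^{hbar l.d/dx} is the
   translation by hbar l. *)
Definition weyl_exp_star (hbar : R) (theta : 'M[R]_n) (k l : V) (f : V -> C)
    (x : V) : C :=
  star_theta theta
    (of_position (fun x' => expi (dot k x') * expi (hbar / 2 * dot k l)))
    (of_position (fun x' => f (x' + hbar *: l))) x 0.

(* {A(x, -i hbar d/dx) *_theta B}(x) *)
Definition weyl_star (hbar : R) (theta : 'M[R]_n) (A : V -> V -> C) (B : V -> C)
    (x : V) : C :=
  ((2 * pi) ^- (3 * n))%:C *
  cintegral (sprod leb (sprod leb leb)) (fun z =>
    let: (k, (l, k')) := z in
    fourier_xp A k l * fourier_x B k' *
    weyl_exp_star hbar theta k l (fun x' => expi (dot k' x')) x).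

End star_product.

(* Main.v *)
(* In a star product one factor can be integrated out: multiplying a plane wave
   of frequencies (k, l) by G on the right multiplies it by G translated by
   (hbar/2 l - k theta/2, - hbar/2 k).  Hence the star product does not depend
   on the superpositions chosen, and, with A~ the Fourier transform of A,
     (A * B)(x, p) = (2 pi)^(-2n) int A~(k, l) e^{i(k.x + l.p)}
                                       B(x + hbar/2 l - k theta/2) dk dl,
     {A *_theta B}(x) = (2 pi)^(-2n) int A~(k, l) e^{i(k.x + hbar/2 k.l)}
                                       B(x + hbar l - k theta/2) dk dl,
   while starring with e^{i y.p} on the right translates x by - hbar/2 y and
   multiplies by e^{i y.p}.  Since A~ and B are integrable, both sides are
   absolutely convergent integrals over (y, k, l), and the measure-preserving
   shear (y, k, l) |-> (y + l, k, l) maps one integrand to the other. *)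
Require Import Defs.
From mathcomp Require Import all_boot all_order all_algebra.
From mathcomp Require Import complex.
From mathcomp Require Import all_classical all_reals all_analysis.
From mathcomp Require Import measurable_realfun ring lra.
Import Order.TTheory GRing.Theory Num.Theory.
Local Open Scope ring_scope.

Set Implicit Arguments.
Unset Strict Implicit.
Unset Printing Implicit Defensive.

Local Open Scope classical_set_scope.
Local Open Scope complex_scope.

(** * Integration of complex functions *)

Section complex_measurability.
Context d (T : measurableType d) (R : realType).
Implicit Types f g : T -> R[i].

Definition cmeasurable f :=
  measurable_fun setT (@complex.Re R \o f) /\
  measurable_fun setT (@complex.Im R \o f).

(* The l^1 norm of R^2: submultiplicative, and measurable without any square
   root. *)
Definition norm1 (z : R[i]) : R := `|complex.Re z| + `|complex.Im z|.

Lemma norm1_ge0 z : 0 <= norm1 z. Proof. by rewrite addr_ge0. Qed.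

Lemma norm1M z w : norm1 (z * w) <= norm1 z * norm1 w.
Proof.
case: z w => [a b] [c e]; rewrite /norm1/=.
rewrite (le_trans (lerD (ler_normB _ _) (ler_normD _ _)))// !normrM.
by rewrite mulrDl !mulrDr; lra.
Qed.

Lemma norm1_expi (t : R) : norm1 (expi t) <= 2.
Proof.
by rewrite /norm1/= -[2]/(1 + 1) lerD// ler_norml ?sin_le1 ?sin_geN1 ?cos_le1 ?cos_geN1.
Qed.

Lemma expiD (s t : R) : expi (s + t) = expi s * expi t.
Proof.
by apply/eqP; rewrite eq_complex/= sinD cosD (addrC (sin s * _)) !eqxx.
Qed.

Lemma expi0 : expi 0 = 1 :> R[i].
Proof. by rewrite /expi cos0 sin0. Qed.

Lemma cmeasurable_norm1 f : cmeasurable f -> measurable_fun setT (norm1 \o f).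
Proof.
move=> [mr mi]; apply: measurable_funD.
  exact: (measurableT_comp (@normr_measurable R setT) mr).
exact: (measurableT_comp (@normr_measurable R setT) mi).
Qed.

Lemma cmeasurableM f g : cmeasurable f -> cmeasurable g ->
  cmeasurable (fun x => f x * g x).
Proof.
move=> [fr fi] [gr gi]; split.
  rewrite (_ : _ \o _ = (complex.Re (R:=R) \o f) \* (complex.Re (R:=R) \o g) \-
    (complex.Im (R:=R) \o f) \* (complex.Im (R:=R) \o g)).
    by apply: measurable_funB; exact: measurable_funM.
  by apply/funext => x /=; case: (f x) (g x) => [? ?] [].
rewrite (_ : _ \o _ = (complex.Re (R:=R) \o f) \* (complex.Im (R:=R) \o g) \+
  (complex.Im (R:=R) \o f) \* (complex.Re (R:=R) \o g)).
  by apply: measurable_funD; exact: measurable_funM.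
by apply/funext => x /=; case: (f x) (g x) => [? ?] [].
Qed.

Lemma cmeasurable_cst (c : R[i]) : cmeasurable (fun _ => c).
Proof. by split; exact: measurable_cst. Qed.

Lemma cmeasurable_expi (h : T -> R) : measurable_fun setT h ->
  cmeasurable (fun x => expi (h x)).
Proof.
move=> mh; split.
  apply: (measurableT_comp (continuous_measurable_fun _) mh).
  exact: continuous_cos.
apply: (measurableT_comp (continuous_measurable_fun _) mh).
exact: continuous_sin.
Qed.

End complex_measurability.

Arguments norm1 {R} z.

Lemma cmeasurable_comp (R : realType) d d' (T : measurableType d)
    (T' : measurableType d') (phi : T' -> T) (f : T -> R[i]) :
  measurable_fun setT phi -> cmeasurable f -> cmeasurable (f \o phi).
Proof.
by move=> mphi [fr fi]; split; [exact: (measurableT_comp fr mphi)|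
                                exact: (measurableT_comp fi mphi)].
Qed.

(** * Integrability criteria and linearity for complex integrals *)

Section complex_integrability.
Context d (T : measurableType d) (R : realType).
Implicit Types f g : T -> R[i].
Variable mu : {measure set T -> \bar R}.

(** [norm1] is the sum of the absolute real and imaginary parts and dominates each of them.
    Integrability thus becomes finiteness of one nonnegative integral, open to Tonelli and to
    substitutions. *)
Lemma cintegrableP f : cintegrable mu f <->
  cmeasurable f /\ (\int[mu]_x (norm1 (f x))%:E < +oo)%E.
Proof.
split=> [[fr fi]|[[mr mi] foo]].
  have mr := measurable_int _ fr; have mi := measurable_int _ fi.
  split; first by split; exact/measurable_EFinP.
  have nf := integrableD measurableT (integrable_abse fr) (integrable_abse fi).
  move: (nf) => /(integrable_lty measurableT); apply: le_lt_trans; apply: ge0_le_integral => //=.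
  - by move=> x _; rewrite lee_fin norm1_ge0.
  - apply/measurable_EFinP/cmeasurable_norm1; split; exact/measurable_EFinP.
  - exact: measurable_int nf.
have mn : measurable_fun setT (EFin \o (norm1 \o f)).
  exact/measurable_EFinP/cmeasurable_norm1.
have inorm : mu.-integrable setT (EFin \o (norm1 \o f)).
  apply/integrableP; split => //.
  by under eq_integral do rewrite /= ger0_norm ?norm1_ge0//.
split; apply: le_integrable inorm => //; try exact/measurable_EFinP.
  by move=> x _ /=; rewrite lee_fin (ger0_norm (norm1_ge0 _)) lerDl.
by move=> x _ /=; rewrite lee_fin (ger0_norm (norm1_ge0 _)) lerDr.
Qed.

Lemma cintegrable_measurable f : cintegrable mu f -> cmeasurable f.
Proof. by case/cintegrableP. Qed.

Lemma cintegrable_le (M : R) f g : cmeasurable f ->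
  (forall x, norm1 (f x) <= M * norm1 (g x)) -> cintegrable mu g ->
  cintegrable mu f.
Proof.
move=> mf fg /cintegrableP[mg goo]; apply/cintegrableP; split => //.
(* The sign of [M] is unknown; [Num.max 0 M] is a nonnegative constant that still gives the bound
   and can leave the integral. *)
have M1 : 0 <= Num.max 0 M by rewrite le_max lexx.
apply: (@le_lt_trans _ _ (\int[mu]_x ((Num.max 0 M)%:E * (norm1 (g x))%:E))%E).
  apply: ge0_le_integral => //=.
  - by move=> x _; rewrite lee_fin norm1_ge0.
  - exact/measurable_EFinP/cmeasurable_norm1.
  - apply/measurable_funeM/measurable_EFinP; exact: cmeasurable_norm1.
  - move=> x _; rewrite -EFinM lee_fin (le_trans (fg x))//.
    by rewrite ler_wpM2r ?norm1_ge0// le_max lexx orbT.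
rewrite ge0_integralZl//; last 2 first.
- exact/measurable_EFinP/cmeasurable_norm1.
- by move=> x _; rewrite lee_fin norm1_ge0.
by rewrite lte_mul_pinfty// ?lee_fin.
Qed.

Lemma cintegrableMbounded (M : R) f g : cintegrable mu f -> cmeasurable g ->
  (forall x, norm1 (g x) <= M) -> cintegrable mu (fun x => f x * g x).
Proof.
move=> fi mg gM; apply: (@cintegrable_le M _ f) => //.
  by apply: cmeasurableM => //; exact: cintegrable_measurable.
move=> x; rewrite mulrC (le_trans (norm1M _ _))//.
by rewrite ler_wpM2r ?norm1_ge0.
Qed.

Lemma cintegrableM_expi f (h : T -> R) : cintegrable mu f ->
  measurable_fun setT h -> cintegrable mu (fun x => f x * expi (h x)).
Proof.
move=> fi mh; apply: (@cintegrableMbounded 2) => //.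
  exact: cmeasurable_expi.
by move=> x; exact: norm1_expi.
Qed.

Lemma cintegrableZl (c : R[i]) f : cintegrable mu f ->
  cintegrable mu (fun x => c * f x).
Proof.
move=> fi; rewrite (_ : (fun x => _) = (fun x => f x * c)); last first.
  by apply/funext => x; rewrite mulrC.
exact: (cintegrableMbounded (M := norm1 c) fi (cmeasurable_cst _ c) (fun=> lexx _)).
Qed.

Lemma cintegralZl (c : R[i]) f : cintegrable mu f ->
  cintegral mu (fun x => c * f x) = c * cintegral mu f.
Proof.
case: c => a b [fr fi]; rewrite /cintegral.
have Z h (r : R) : mu.-integrable setT (EFin \o h) ->
    mu.-integrable setT (EFin \o (fun x => r * h x)).
  by move=> /(integrableZl measurableT r).
apply/eqP; rewrite eq_complex /= -!RintegralZl// -RintegralB//; try exact: Z.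
rewrite -RintegralD//; try exact: Z.
by apply/andP; split; apply/eqP; apply: eq_Rintegral => x _; case: (f x).
Qed.

Lemma eq_cintegral f g : f =1 g -> cintegral mu f = cintegral mu g.
Proof. by move=> /funext ->. Qed.

End complex_integrability.

(** * Measure-preserving substitutions *)

Section measure_preserving.
Context (R : realType) d1 d2 (T1 : measurableType d1) (T2 : measurableType d2).
Variables (mu : {measure set T1 -> \bar R}) (nu : {measure set T2 -> \bar R}).
Local Open Scope ereal_scope.

(** Phrased with nonnegative integrals instead of measures of sets, so that instances come directly
    from Tonelli and from Lebesgue substitutions. *)
Definition preserving (phi : T1 -> T2) := measurable_fun setT phi /\
  forall h : T2 -> \bar R, measurable_fun setT h -> (forall y, 0 <= h y) ->
    \int[mu]_x h (phi x) = \int[nu]_y h y.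

Variables (phi : T1 -> T2) (phiP : preserving phi).

(** Positive and negative parts commute with composition, and the integral is by definition the
    difference of theirs. *)
Lemma preserving_integral (h : T2 -> \bar R) : measurable_fun setT h ->
  \int[mu]_x h (phi x) = \int[nu]_y h y.
Proof.
case: phiP => mphi phiE mh.
have mp := measurable_funepos mh; have mn := measurable_funeneg mh.
rewrite [LHS]integralE [RHS]integralE.
rewrite -(phiE _ mp (funepos_ge0 h)) -(phiE _ mn (funeneg_ge0 h)).
by rewrite -[fun x => h (phi x)]/(h \o phi) funepos_comp funeneg_comp.
Qed.

Lemma preserving_cintegrable f : cintegrable nu f -> cintegrable mu (f \o phi).
Proof.
case: phiP => mphi phiE /cintegrableP[mf foo]; apply/cintegrableP; split.
  exact: cmeasurable_comp.
rewrite (phiE (fun x => (norm1 (f x))%:E))//.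
  exact/measurable_EFinP/cmeasurable_norm1.
by move=> y; rewrite lee_fin norm1_ge0.
Qed.

Lemma preserving_cintegral f : cmeasurable f ->
  cintegral mu (f \o phi) = cintegral nu f.
Proof.
case=> mr mi; rewrite /cintegral /Rintegral.
congr (fine _ +i* fine _)%C.
- by rewrite -(preserving_integral (h := EFin \o (@complex.Re R \o f)))//; exact/measurable_EFinP.
- by rewrite -(preserving_integral (h := EFin \o (@complex.Im R \o f)))//; exact/measurable_EFinP.
Qed.

End measure_preserving.

(** * Tonelli and Fubini for complex integrands *)

Section complex_fubini.
Context (R : realType) d1 d2 (T1 : measurableType d1) (T2 : measurableType d2).
Variables (m1 : {sigma_finite_measure set T1 -> \bar R}).
Variables (m2 : {sigma_finite_measure set T2 -> \bar R}).

Lemma ge0_integral_sprod (h : T1 * T2 -> \bar R) :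
  measurable_fun setT h -> (forall z, 0 <= h z)%E ->
  (\int[sprod m1 m2]_z h z = \int[m1]_x \int[m2]_y h (x, y))%E.
Proof. by move=> mh h0; exact: fubini_tonelli1. Qed.

Lemma ge0_integral_sprod_sym (h : T1 * T2 -> \bar R) :
  measurable_fun setT h -> (forall z, 0 <= h z)%E ->
  (\int[sprod m1 m2]_z h z = \int[m2]_y \int[m1]_x h (x, y))%E.
Proof. by move=> mh h0; exact: fubini_tonelli2. Qed.

(** The real-valued inner integral is [fine] of the extended one. Both agree almost everywhere,
    since the extended inner integral is integrable, hence almost everywhere finite. *)
Let Rfubini (g : T1 * T2 -> R) :
    (sprod m1 m2).-integrable setT (EFin \o g) ->
  m1.-integrable setT (EFin \o (fun x => \int[m2]_y g (x, y))) /\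
  \int[sprod m1 m2]_z g z = \int[m1]_x \int[m2]_y g (x, y).
Proof.
move=> gi; have Fi := @integrable_fubini_F _ _ _ _ _ m1 m2 _ gi.
have mF := measurable_int _ Fi.
have mfF : measurable_fun setT (EFin \o (fun x => \int[m2]_y g (x, y))).
  by apply/measurable_EFinP; apply: (measurableT_comp (fine_measurable measurableT) mF).
split.
  (* [fine] sends infinite values to 0, so it never increases the absolute value. *)
  apply: le_integrable Fi => // x _ /=; rewrite /fubini_F /Rintegral /=.
  by case: (\int[m2]_y _)%E => [r||] //=; rewrite leey.
rewrite /Rintegral; congr fine.
rewrite -(integral12_prod_meas1 gi); apply: ae_eq_integral => //.
have := integrable_ae measurableT Fi.
apply: filterS => x /= /(_ I) Fx _.
by rewrite fineK.
Qed.

Lemma cfubini (f : T1 * T2 -> R[i]) : cintegrable (sprod m1 m2) f ->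
  cintegrable m1 (fun x => cintegral m2 (fun y => f (x, y))) /\
  cintegral (sprod m1 m2) f = cintegral m1 (fun x => cintegral m2 (fun y => f (x, y))).
Proof.
move=> [/Rfubini[ri rE] /Rfubini[ii iE]]; split; first by split.
by rewrite {1}/cintegral rE iE.
Qed.

(** Submultiplicativity of [norm1] bounds the integrand by a product of nonnegative functions, whose
    integral factors by Tonelli. *)
Lemma cintegrable_sprodM (f : T1 -> R[i]) (g : T2 -> R[i]) :
  cintegrable m1 f -> cintegrable m2 g ->
  cintegrable (sprod m1 m2) (fun z => f z.1 * g z.2).
Proof.
move=> /cintegrableP[mf foo] /cintegrableP[mg goo].
have mf1 : cmeasurable (fun z : T1 * T2 => f z.1).
  exact: (cmeasurable_comp measurable_fst mf).
have mg2 : cmeasurable (fun z : T1 * T2 => g z.2).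
  exact: (cmeasurable_comp measurable_snd mg).
apply/cintegrableP; split; first exact: cmeasurableM.
have mn1 := cmeasurable_norm1 mf; have mn2 := cmeasurable_norm1 mg.
have M : measurable_fun setT (fun z : T1 * T2 => (norm1 (f z.1) * norm1 (g z.2))%:E).
  apply/measurable_EFinP; apply: measurable_funM.
    exact: (cmeasurable_norm1 mf1).
  exact: (cmeasurable_norm1 mg2).
have n0 z : (0 <= (norm1 (f z.1) * norm1 (g z.2))%:E)%E.
  by rewrite lee_fin mulr_ge0// norm1_ge0.
apply: (@le_lt_trans _ _
  (\int[sprod m1 m2]_z (norm1 (f z.1) * norm1 (g z.2))%:E)%E).
  apply: ge0_le_integral => //=.
  - by move=> x _; rewrite lee_fin norm1_ge0.
  - by apply/measurable_EFinP; apply: cmeasurable_norm1; exact: cmeasurableM.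
  - by move=> x _; rewrite lee_fin norm1M.
rewrite ge0_integral_sprod//=.
under eq_integral => x _.
  under eq_integral do rewrite EFinM.
  rewrite ge0_integralZl//; last 3 first.
  - exact/measurable_EFinP.
  - by move=> y _; rewrite lee_fin norm1_ge0.
  - by rewrite lee_fin norm1_ge0.
  over.
rewrite ge0_integralZr//; last 3 first.
- exact/measurable_EFinP.
- by move=> y _; rewrite lee_fin norm1_ge0.
- by apply: integral_ge0 => y _; rewrite lee_fin norm1_ge0.
rewrite lte_mul_pinfty//.
  by apply: integral_ge0 => y _; rewrite lee_fin norm1_ge0.
by rewrite ge0_fin_numE//; apply: integral_ge0 => y _; rewrite lee_fin norm1_ge0.
Qed.

End complex_fubini.

(** * Exchange and reassociation of factors in product measures *)

Section sprod_symmetries.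
Context (R : realType) d1 d2 d3 (T1 : measurableType d1) (T2 : measurableType d2)
  (T3 : measurableType d3).
Variables (m1 : {sigma_finite_measure set T1 -> \bar R}).
Variables (m2 : {sigma_finite_measure set T2 -> \bar R}).
Variables (m3 : {sigma_finite_measure set T3 -> \bar R}).

Lemma preserving_swap :
  preserving (sprod m2 m1) (sprod m1 m2) (fun z => (z.2, z.1)).
Proof.
have mswap : measurable_fun setT (fun z : T2 * T1 => (z.2, z.1)).
  by apply/measurable_fun_pair => /=; [exact: measurable_snd|exact: measurable_fst].
split=> // h mh h0; rewrite ge0_integral_sprod//.
  by rewrite ge0_integral_sprod_sym.
exact: (measurableT_comp mh mswap).
Qed.

Lemma measurable_prodA :
  measurable_fun setT (fun z : T1 * (T2 * T3) => ((z.1, z.2.1), z.2.2)).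
Proof.
apply/measurable_fun_pair => /=; last first.
  exact: (measurableT_comp measurable_snd measurable_snd).
apply/measurable_fun_pair => /=; first exact: measurable_fst.
exact: (measurableT_comp measurable_fst measurable_snd).
Qed.

(** Tonelli unfolds both sides to the same triple iterated integral. *)
Lemma preserving_prodA : preserving (sprod m1 (sprod m2 m3))
  (sprod (sprod m1 m2) m3) (fun z => ((z.1, z.2.1), z.2.2)).
Proof.
split; first exact: measurable_prodA.
move=> h mh h0; rewrite ge0_integral_sprod//; last first.
  exact: (measurableT_comp mh measurable_prodA).
have mhx x : measurable_fun setT (fun z : T2 * T3 => h (x, z.1, z.2)).
  apply: (measurableT_comp mh); apply/measurable_fun_pair => /=.
    by apply/measurable_fun_pair => /=; [exact: measurable_cst|exact: measurable_fst].
  exact: measurable_snd.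
rewrite ge0_integral_sprod//.
rewrite ge0_integral_sprod//=.
- by apply: eq_integral => x _; rewrite ge0_integral_sprod.
- exact: (measurable_fun_fubini_tonelli_F h).
- by move=> z; apply: integral_ge0.
Qed.

Lemma cfubini_sym (f : T1 * T2 -> R[i]) : cintegrable (sprod m1 m2) f ->
  cintegrable m2 (fun y => cintegral m1 (fun x => f (x, y))) /\
  cintegral (sprod m1 m2) f = cintegral m2 (fun y => cintegral m1 (fun x => f (x, y))).
Proof.
move=> fi; have P := preserving_swap.
have [ii <-] := cfubini (preserving_cintegrable P fi).
by split=> //; rewrite (preserving_cintegral P)//; exact: cintegrable_measurable fi.
Qed.

End sprod_symmetries.

(** * Affine maps of R^n *)

Section rV_measurability.
Context d (T : measurableType d) (R : realType) (n : nat).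
Implicit Types (f g : T -> 'rV[R]_n) (a : T -> R).

Lemma measurable_rVD f g : measurable_fun setT f -> measurable_fun setT g ->
  measurable_fun setT (fun t => f t + g t).
Proof.
move=> mf mg; apply: measurable_rVP => i.
rewrite (_ : _ \o _ = (coordinate i \o f) \+ (coordinate i \o g)).
  by apply: measurable_funD; apply: measurableT_comp => //; exact: measurable_coordinate.
by apply/funext => t; rewrite /= /coordinate mxE.
Qed.

Lemma measurable_rVZ (c : R) f : measurable_fun setT f ->
  measurable_fun setT (fun t => c *: f t).
Proof.
move=> mf; apply: measurable_rVP => i.
rewrite (_ : _ \o _ = (fun t => c * (coordinate i \o f) t)).
  by apply: measurable_funM => //; apply: measurableT_comp => //; exact: measurable_coordinate.
by apply/funext => t; rewrite /= /coordinate mxE.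
Qed.

Lemma measurable_rVB f g : measurable_fun setT f -> measurable_fun setT g ->
  measurable_fun setT (fun t => f t - g t).
Proof.
move=> mf mg; under eq_fun do rewrite -scaleN1r.
by apply: measurable_rVD => //; exact: measurable_rVZ.
Qed.

Lemma measurable_rV_mulmx (M : 'M[R]_n) f : measurable_fun setT f ->
  measurable_fun setT (fun t => f t *m M).
Proof.
move=> mf; apply: measurable_rVP => i.
rewrite (_ : _ \o _ = (fun t => \sum_j ((coordinate j \o f) t * M j i))).
  apply: measurable_sum => j; apply: measurable_funM => //.
  by apply: measurableT_comp => //; exact: measurable_coordinate.
by apply/funext => t; rewrite /= /coordinate mxE.
Qed.

Lemma measurable_dot f g : measurable_fun setT f -> measurable_fun setT g ->
  measurable_fun setT (fun t => dot (f t) (g t)).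
Proof.
move=> mf mg; apply: measurable_sum => i; apply: measurable_funM.
  exact: (measurableT_comp (measurable_coordinate i) mf).
exact: (measurableT_comp (measurable_coordinate i) mg).
Qed.

End rV_measurability.

Section dot_algebra.
Context (R : realType) (n : nat).
Implicit Types (k l x y : 'rV[R]_n) (a : R).

Lemma dotC k x : dot k x = dot x k.
Proof. by apply: eq_bigr => i _; rewrite mulrC. Qed.

Lemma dotDl k l x : dot (k + l) x = dot k x + dot l x.
Proof. by rewrite -big_split; apply: eq_bigr => i _; rewrite mxE mulrDl. Qed.

Lemma dotZl a k x : dot (a *: k) x = a * dot k x.
Proof. by rewrite mulr_sumr; apply: eq_bigr => i _; rewrite mxE mulrA. Qed.

Lemma dotDr k x y : dot k (x + y) = dot k x + dot k y.
Proof. by rewrite dotC dotDl !(dotC _ k). Qed.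

Lemma dotZr a k x : dot k (a *: x) = a * dot k x.
Proof. by rewrite dotC dotZl dotC. Qed.

Lemma dotNr k x : dot k (- x) = - dot k x.
Proof. by rewrite -scaleN1r dotZr mulN1r. Qed.

Lemma dot0l x : dot 0 x = 0.
Proof. by rewrite -(scale0r 0) dotZl mul0r. Qed.

Lemma dot0r x : dot x 0 = 0.
Proof. by rewrite dotC dot0l. Qed.

(** Turns the theta phase into a dot product with [k'], so that it can be read as a translation of
    the position paired with [k']. *)
Lemma theta_formE (theta : 'M[R]_n) k k' :
  theta_form theta k k' = dot (k *m theta) k'.
Proof.
rewrite /theta_form exchange_big; apply: eq_bigr => j _ /=.
by rewrite mxE mulr_suml; apply: eq_bigr => i _; rewrite (mulrC (theta i j)).
Qed.

Lemma theta_form_trmx (theta : 'M[R]_n) k k' :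
  theta_form theta k k' = dot (k' *m theta^T) k.
Proof.
rewrite /theta_form; apply: eq_bigr => i _ /=.
rewrite mxE mulr_suml; apply: eq_bigr => j _.
by rewrite mxE; ring.
Qed.

End dot_algebra.

(** * Affine substitutions in Lebesgue integrals *)

Section affine_substitution.
Context (R : realType).
Local Open Scope ereal_scope.

(** By uniqueness of Lebesgue measure: the pushforward under the affine map, scaled by [|a|], gives
    each half-open interval its length. *)
Lemma ge0_integral_affine1 (a b : R) (h : R -> \bar R) : a != 0%R ->
  measurable_fun setT h -> (forall t, 0 <= h t) ->
  `|a|%:E * \int[lebesgue_measure]_t h (a * t + b)%R =
  \int[lebesgue_measure]_t h t.
Proof.
move=> a0 mh h0; pose phi (t : measurableTypeR R) : measurableTypeR R := (a * t + b)%R.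
have mphi : measurable_fun setT phi by apply: measurable_funD => //; exact: mulrl_measurable.
have k0 : (0 <= `|a|)%R by [].
rewrite [RHS](@eq_measure_integral _ _ _ _ (mscale (NngNum k0) (pushforward lebesgue_measure phi))) //=.
  rewrite ge0_integral_mscale// ge0_integral_pushforward//.
move=> A mA _; apply: lebesgue_measure_unique => //= _ [[x y] _ <-].
rewrite /mscale /= -[pushforward _ _ _]/(lebesgue_measure (phi @^-1` `]x, y])).
have [agt0|alt0|aeq0] := ltgtP a 0%R; last by rewrite aeq0 eqxx in a0.
(* This is the case [a < 0]: the map reverses order, so the preimage is closed on the left and open
   on the right. *)
- rewrite (_ : phi @^-1` _ = `[(y - b) / a, (x - b) / a[%classic)%R.
    rewrite !lebesgue_measure_itv/= !lte_fin ltr_ndivrMr// divfK// ltrD2r.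
    case: ifPn => xy; last by rewrite mule0.
    by rewrite -!EFinD -EFinM; congr EFin; rewrite ltr0_norm//; field.
  apply/seteqP; split => t /=; rewrite !in_itv/= /phi ler_ndivrMr// ltr_ndivlMr//; lra.
- rewrite (_ : phi @^-1` _ = `](x - b) / a, (y - b) / a]%classic)%R.
    rewrite !lebesgue_measure_itv/= !lte_fin ltr_pdivrMr// divfK// ltrD2r.
    case: ifPn => xy; last by rewrite mule0.
    by rewrite -!EFinD -EFinM; congr EFin; rewrite gtr0_norm//; field.
  apply/seteqP; split => t /=; rewrite !in_itv/= /phi ltr_pdivrMr// ler_pdivlMr//; lra.
Qed.

(** Induction on the dimension: [rV_cons] splits off the first coordinate, on which the
    one-dimensional case acts, and Tonelli leaves the others to the induction hypothesis. *)
Lemma ge0_integral_affine n (a : R) (b : 'rV[R]_n) (h : 'rV[R]_n -> \bar R) :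
  a != 0%R -> measurable_fun setT h -> (forall v, 0 <= h v) ->
  (`|a| ^+ n)%:E * \int[lebesgue_rV n]_v h (a *: v + b)%R =
  \int[lebesgue_rV n]_v h v.
Proof.
move=> a0; elim: n b h => [|n IH] b h mh h0.
  (* In dimension 0 there is a single point and the scaling factor is 1. *)
  rewrite expr0 mul1e; apply: eq_integral => v _.
  by congr h; apply/rowP => -[].
have mcons := @measurable_rV_cons R n.
have maff : measurable_fun setT (fun v : 'rV[R]_n.+1 => h (a *: v + b)%R).
  apply: (measurableT_comp mh); apply: measurable_rVD; last exact: measurable_cst.
  by apply: measurable_rVZ; exact: measurable_id.
rewrite /= /rV_cons_measure !ge0_integral_pushforward//=.
rewrite !preimage_setT !ge0_integral_sprod//; last 2 first.
- exact: (measurableT_comp mh mcons).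
- exact: (measurableT_comp maff mcons).
pose b' : 'rV[R]_n := (\row_j b ord0 (lift ord0 j))%R.
have consE t v : (a *: rV_cons (t, v) + b = rV_cons (a * t + b ord0 ord0, a *: v + b'))%R.
  apply/rowP => i; rewrite !mxE/=.
  by case: unliftP => [j ->|->]/=; rewrite /coordinate ?mxE.
have mht t : measurable_fun setT (fun v => h (rV_cons (t, v))).
  by apply: (measurableT_comp mh); apply: (measurableT_comp mcons); exact: measurable_pair1.
(* [|a| ^+ n] moves under the outer integral for the induction hypothesis; the remaining [|a|]
   serves the first coordinate. *)
rewrite exprS EFinM -muleA -ge0_integralZl//=.
- under eq_integral => t _.
    rewrite /=; under eq_integral do rewrite consE.
    rewrite (IH _ (fun v => h (rV_cons ((a * t + b ord0 ord0)%R, v))))//.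
    over.
  rewrite (ge0_integral_affine1 _ (h := fun t => \int[lebesgue_rV n]_v h (rV_cons (t, v))))//.
    apply: (measurable_fun_fubini_tonelli_F (fun z => h (rV_cons z))) => //.
    exact: (measurableT_comp mh mcons).
  by move=> t; apply: integral_ge0.
- apply: (measurable_fun_fubini_tonelli_F (fun z => h (a *: rV_cons z + b)%R)) => //.
  exact: (measurableT_comp maff mcons).
- by move=> t _; apply: integral_ge0.
Qed.

Lemma preserving_translation n (b : 'rV[R]_n) :
  preserving (lebesgue_rV n) (lebesgue_rV n) (fun v => v + b)%R.
Proof.
split.
  by apply: measurable_rVD; [exact: measurable_id|exact: measurable_cst].
move=> h mh h0; rewrite -(@ge0_integral_affine n 1 b h)//.
by rewrite normr1 expr1n mul1e; under [RHS]eq_integral do rewrite scale1r.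
Qed.

Lemma cintegrable_affine n (a : R) (b : 'rV[R]_n) (f : 'rV[R]_n -> R[i]) :
  a != 0%R -> cintegrable (lebesgue_rV n) f ->
  cintegrable (lebesgue_rV n) (fun v => f (a *: v + b)%R).
Proof.
move=> a0 /cintegrableP[mf foo]; apply/cintegrableP; split.
  apply: (cmeasurable_comp _ mf); apply: measurable_rVD; last exact: measurable_cst.
  by apply: measurable_rVZ; exact: measurable_id.
have := foo; rewrite -(ge0_integral_affine b a0 (h := fun v => (norm1 (f v))%:E))//.
(* Were the substituted integral infinite, its product with the positive number [|a| ^+ n] would be
   infinite too. *)
- apply: contraTT; rewrite -!leNgt !leye_eq => /eqP ->.
  by rewrite gt0_muley// lte_fin exprn_gt0// normr_gt0.
- exact/measurable_EFinP/cmeasurable_norm1.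
- by move=> v; rewrite lee_fin norm1_ge0.
Qed.

End affine_substitution.

Section shear.
Context (R : realType) (n : nat) d (T : measurableType d).
Variables (mu : {sigma_finite_measure set T -> \bar R}) (u : T -> 'rV[R]_n).
Hypothesis mu_u : measurable_fun setT u.

(** At a fixed second coordinate the map is a translation, so integrating over the vector first
    reduces to translation invariance. *)
Lemma preserving_shear : preserving (sprod (lebesgue_rV n) mu)
  (sprod (lebesgue_rV n) mu) (fun z => (z.1 + u z.2, z.2)).
Proof.
have mshear : measurable_fun setT (fun z : 'rV[R]_n * T => (z.1 + u z.2, z.2)).
  apply/measurable_fun_pair => /=; last exact: measurable_snd.
  apply: measurable_rVD; first exact: measurable_fst.
  exact: (measurableT_comp mu_u measurable_snd).
split=> // h mh h0; rewrite !ge0_integral_sprod_sym//; last first.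
  exact: (measurableT_comp mh mshear).
apply: eq_integral => t _ /=.
have [_ /(_ (fun v => h (v, t))) -> //] := preserving_translation (u t).
exact: (measurableT_comp mh (measurable_pair2 t)).
Qed.

End shear.

Section dirac_integral.
Context (R : realType) d (T : measurableType d) (a : T).

Lemma cintegrable_dirac (c : R[i]) : cintegrable (\d_a) (fun _ : T => c).
Proof.
apply/cintegrableP; split; first exact: cmeasurable_cst.
by rewrite integral_dirac// diracT mul1e ltry.
Qed.

Lemma cintegral_dirac (f : T -> R[i]) : cmeasurable f ->
  cintegral (\d_a) f = f a.
Proof.
case=> mr mi; rewrite /cintegral /Rintegral !integral_dirac//; last 2 first.
- exact/measurable_EFinP.
- exact/measurable_EFinP.
by rewrite diracT !mul1e/=; case: (f a).
Qed.

End dirac_integral.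

(** * Star products of superpositions *)

Section star_theory.
Context (R : realType) (n : nat).
Local Notation V := 'rV[R]_n.
Local Notation C := R[i].
Local Notation leb := (@lebesgue_rV R n).
Implicit Types (S : superposition R n) (F G : V -> V -> C) (k l x p y : V).
Implicit Types (hbar : R) (theta : 'M[R]_n).

Lemma measurable_phase d (T : measurableType d) (k l x p : T -> V) :
  measurable_fun setT k -> measurable_fun setT l ->
  measurable_fun setT x -> measurable_fun setT p ->
  measurable_fun setT (fun t => dot (k t) (x t) + dot (l t) (p t)).
Proof. by move=> *; apply: measurable_funD; exact: measurable_dot. Qed.

(** The cocycle phase is linear in [(k', l')], so it is absorbed into the point at which the second
    wave is evaluated. *)
Lemma star_wave_left hbar theta k l k' l' x p :
  star_wave hbar theta k l k' l' x p = wave k l x p *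
    wave k' l' (x + (hbar / 2) *: l - 2^-1 *: (k *m theta)) (p - (hbar / 2) *: k).
Proof.
rewrite /star_wave /wave_cocycle /wave theta_formE -!expiD; congr expi.
rewrite !(dotDl, dotDr, dotNr, dotZr).
rewrite (dotC k' l) (dotC k' (k *m theta)) (dotC l' k).
by field.
Qed.

(** The cocycle phase is also linear in [(k, l)]; reading the theta form in its first argument
    brings in the transpose. *)
Lemma star_wave_right hbar theta k l k' l' x p :
  star_wave hbar theta k l k' l' x p = wave k' l' x p *
    wave k l (x - (hbar / 2) *: l' - 2^-1 *: (k' *m theta^T)) (p + (hbar / 2) *: k').
Proof.
rewrite /star_wave /wave_cocycle /wave theta_form_trmx -!expiD; congr expi.
rewrite !(dotDl, dotDr, dotNr, dotZr).
rewrite (dotC k' l) (dotC k (k' *m theta^T)).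
by field.
Qed.

Definition star_phase hbar theta k l k' l' x p : R :=
  dot k x + dot l p +
  (dot k' (x + (hbar / 2) *: l - 2^-1 *: (k *m theta)) + dot l' (p - (hbar / 2) *: k)).

Lemma star_wave_phase hbar theta k l k' l' x p :
  star_wave hbar theta k l k' l' x p = expi (star_phase hbar theta k l k' l' x p).
Proof. by rewrite star_wave_left /wave -expiD. Qed.

Lemma cintegrable_superpose S x p :
  cintegrable (weight S) (fun s => amplitude s * wave (xfreq s) (pfreq s) x p).
Proof.
apply: cintegrableM_expi; first exact: amplitude_integrable.
apply: measurable_phase.
- exact: measurable_xfreq.
- exact: measurable_pfreq.
- exact: measurable_cst.
- exact: measurable_cst.
Qed.

Lemma measurable_star_phase hbar theta S S' x p :
  measurable_fun setT (fun s : mode S * mode S' => star_phase hbar theta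
    (xfreq s.1) (pfreq s.1) (xfreq s.2) (pfreq s.2) x p).
Proof.
have mx := measurableT_comp (@measurable_xfreq _ _ S) measurable_fst.
have mp := measurableT_comp (@measurable_pfreq _ _ S) measurable_fst.
have mx' := measurableT_comp (@measurable_xfreq _ _ S') measurable_snd.
have mp' := measurableT_comp (@measurable_pfreq _ _ S') measurable_snd.
apply: measurable_funD; first by apply: measurable_phase => //; exact: measurable_cst.
apply: measurable_phase => //.
  apply: measurable_rVB.
    by apply: measurable_rVD; [exact: measurable_cst|exact: measurable_rVZ].
  by apply: measurable_rVZ; exact: measurable_rV_mulmx.
apply: measurable_rVB; first exact: measurable_cst.
exact: measurable_rVZ.
Qed.

Lemma cintegrable_star hbar theta S S' x p :
  cintegrable (sprod (weight S) (weight S')) (fun s =>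
    amplitude s.1 * amplitude s.2 *
    star_wave hbar theta (xfreq s.1) (pfreq s.1) (xfreq s.2) (pfreq s.2) x p).
Proof.
under [fun s => _]eq_fun do rewrite star_wave_phase.
apply: cintegrableM_expi; last exact: measurable_star_phase.
apply: cintegrable_sprodM; exact: amplitude_integrable.
Qed.

(** Integrating over the modes of [S'] first rebuilds [superpose S'] at a translated point. The
    value therefore depends on [S'] through its superposition alone. *)
Lemma star_superposition_left hbar theta S S' x p :
  let f s := amplitude s * wave (xfreq s) (pfreq s) x p *
    superpose S' (x + (hbar / 2) *: pfreq s - 2^-1 *: (xfreq s *m theta))
                 (p - (hbar / 2) *: xfreq s) in
  cintegrable (weight S) f /\
  star_superposition hbar theta S S' x p = cintegral (weight S) f.
Proof.
move=> f; rewrite /star_superposition.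
have := cfubini (cintegrable_star hbar theta S S' x p).
rewrite (_ : (fun s => cintegral (weight S') _) = f)//.
apply/funext => s; rewrite /f -cintegralZl; last exact: cintegrable_superpose.
by apply: eq_cintegral => s'; rewrite star_wave_left /= mulrACA.
Qed.

Lemma star_superposition_right hbar theta S S' x p :
  star_superposition hbar theta S S' x p =
  cintegral (weight S') (fun s => amplitude s * wave (xfreq s) (pfreq s) x p *
    superpose S (x - (hbar / 2) *: pfreq s - 2^-1 *: (xfreq s *m theta^T))
                (p + (hbar / 2) *: xfreq s)).
Proof.
rewrite /star_superposition; have [_ ->] := cfubini_sym (cintegrable_star hbar theta S S' x p).
apply: eq_cintegral => s; rewrite -cintegralZl; last exact: cintegrable_superpose.
by apply: eq_cintegral => s'; rewrite star_wave_right /= (mulrC (amplitude s')) mulrACA.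
Qed.

(** For any other representatives [U] and [U'], the right formula replaces [U] by [S], then the left
    formula replaces [U'] by [S']; so the set read by [xget] has one element. *)
Lemma starE hbar theta S S' x p :
  star hbar theta (superpose S) (superpose S') x p =
  star_superposition hbar theta S S' x p.
Proof.
apply: xget_unique; first by exists S, S'.
move=> _ [U [U' [UE U'E ->]]].
rewrite star_superposition_right UE -star_superposition_right.
have [_ ->] := star_superposition_left hbar theta S U' x p.
by rewrite U'E; have [_ <-] := star_superposition_left hbar theta S S' x p.
Qed.

(** A Dirac weight on a one-point space makes a single exponential a superposition. *)
Definition point_superposition (c : C) k l : superposition R n :=
  @Superposition R n _ unit (\d_tt) (fun=> c) (fun=> k) (fun=> l)
    (cintegrable_dirac tt c) (measurable_cst k) (measurable_cst l).

Lemma superpose_point c k l :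
  superpose (point_superposition c k l) = fun x p => c * wave k l x p.
Proof.
apply/funext => x; apply/funext => p; apply: cintegral_dirac.
exact: cmeasurable_cst.
Qed.

Lemma star_point_left hbar theta c k l S x p :
  star hbar theta (fun x' p' => c * wave k l x' p') (superpose S) x p =
  c * wave k l x p * superpose S (x + (hbar / 2) *: l - 2^-1 *: (k *m theta))
                                 (p - (hbar / 2) *: k).
Proof.
rewrite -superpose_point starE.
have [_ ->] := star_superposition_left hbar theta (point_superposition c k l) S x p.
by rewrite cintegral_dirac//; exact: cmeasurable_cst.
Qed.

Lemma star_point_right hbar theta c k l S x p :
  star hbar theta (superpose S) (fun x' p' => c * wave k l x' p') x p =
  c * wave k l x p * superpose S (x - (hbar / 2) *: l - 2^-1 *: (k *m theta^T))
                                 (p + (hbar / 2) *: k).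
Proof.
rewrite -superpose_point starE star_superposition_right.
by rewrite cintegral_dirac//; exact: cmeasurable_cst.
Qed.

(** * Closure of superpositions under the star product *)

Section product.
Variables (hbar : R) (theta : 'M[R]_n) (S S' : superposition R n).

(** A wave equals 1 at the origin, so the star wave taken there is just the cocycle. *)
Let ampl (s : mode S * mode S') := amplitude s.1 * amplitude s.2 *
  star_wave hbar theta (xfreq s.1) (pfreq s.1) (xfreq s.2) (pfreq s.2) 0 0.

Let mx : measurable_fun setT (fun s : mode S * mode S' => xfreq s.1 + xfreq s.2).
Proof.
apply: measurable_rVD; first exact: measurableT_comp (@measurable_xfreq _ _ S) measurable_fst.
exact: measurableT_comp (@measurable_xfreq _ _ S') measurable_snd.
Qed.

Let mp : measurable_fun setT (fun s : mode S * mode S' => pfreq s.1 + pfreq s.2).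
Proof.
apply: measurable_rVD; first exact: measurableT_comp (@measurable_pfreq _ _ S) measurable_fst.
exact: measurableT_comp (@measurable_pfreq _ _ S') measurable_snd.
Qed.

(** Needed for iterated products: [star] takes its default value 0 on a factor that is not a
    superposition. *)
Definition product_superposition : superposition R n :=
  @Superposition R n _ _ (sprod (weight S) (weight S')) ampl _ _
    (cintegrable_star hbar theta S S' 0 0) mx mp.

Lemma superpose_product : superpose product_superposition =
  star hbar theta (superpose S) (superpose S').
Proof.
apply/funext => x; apply/funext => p; rewrite starE.
apply: eq_cintegral => s /=; rewrite /ampl /star_wave -!mulrA; do 3 congr (_ * _).
by rewrite {1}/wave !dot0r addr0 expi0 mul1r.
Qed.

End product.

End star_theory.

(** * Proper functions *)

Section proper_functions.
Context (R : realType) (n : nat).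
Local Notation V := 'rV[R]_n.
Local Notation C := R[i].
Local Notation leb := (@lebesgue_rV R n).
Implicit Types (k l x p y : V).

Variables (hbar : R) (theta : 'M[R]_n) (A : V -> V -> C) (B : V -> C).
Hypotheses (A_proper : proper_xp A) (B_proper : proper_x B).

Let alpha (z : V * V) : C := ((2 * pi) ^- (2 * n))%:C * fourier_xp A z.1 z.2.
Let beta (k : V) : C := ((2 * pi) ^- n)%:C * fourier_x B k.

Let alpha_integrable : cintegrable (sprod leb leb) alpha.
Proof. by have [_ Ai _] := A_proper; exact: cintegrableZl. Qed.

Let beta_integrable : cintegrable leb beta.
Proof. by have [_ Bi _] := B_proper; exact: cintegrableZl. Qed.

Let SA : superposition R n := @Superposition R n _ _ (sprod leb leb) alpha _ _
  alpha_integrable measurable_fst measurable_snd.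

Let SB : superposition R n := @Superposition R n _ _ leb beta id (fun=> 0)
  beta_integrable (@measurable_id _ _ setT) (measurable_cst (0 : V)).

Lemma superpose_proper_xp : superpose SA = A.
Proof.
have [_ Ai AE] := A_proper; apply/funext => x; apply/funext => p.
rewrite AE -cintegralZl; last first.
  apply: cintegrableM_expi => //.
  exact: (measurable_phase measurable_fst measurable_snd (measurable_cst x) (measurable_cst p)).
by apply: eq_cintegral => z; rewrite /= mulrA.
Qed.

Lemma proper_xE x :
  B x = cintegral leb (fun k => beta k * expi (dot k x)).
Proof.
have [_ Bi ->] := B_proper; rewrite -cintegralZl; last first.
  by apply: cintegrableM_expi => //; exact: (measurable_dot (@measurable_id _ _ setT) (measurable_cst _)).
by apply: eq_cintegral => z; rewrite /= mulrA.
Qed.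

Lemma superpose_proper_x : superpose SB = of_position B.
Proof.
apply/funext => x; apply/funext => p; rewrite /of_position proper_xE.
by apply: eq_cintegral => k /=; rewrite /wave dot0l addr0.
Qed.

Definition star_product_superposition := product_superposition hbar theta SA SB.

Lemma superpose_star_proper :
  superpose star_product_superposition = star hbar theta A (of_position B).
Proof. by rewrite superpose_product superpose_proper_xp superpose_proper_x. Qed.

(** [B] stays a function instead of being expanded in waves, so that its integrability can later
    control the integral over [y]. *)
Lemma star_properE x p :
  let f z := alpha z * wave z.1 z.2 x p *
    B (x + (hbar / 2) *: z.2 - 2^-1 *: (z.1 *m theta)) in
  cintegrable (sprod leb leb) f /\
  star hbar theta A (of_position B) x p = cintegral (sprod leb leb) f.
Proof.
rewrite -superpose_proper_xp -superpose_proper_x starE.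
have := star_superposition_left hbar theta SA SB x p.
by rewrite /= superpose_proper_x.
Qed.

(** Both factors are constant multiples of plane waves without momentum frequency, so the left one
    only translates the right one by the theta term. *)
Lemma weyl_exp_starE k l k' x :
  weyl_exp_star hbar theta k l (fun x' => expi (dot k' x')) x =
  expi (dot k x + hbar / 2 * dot k l) *
  expi (dot k' (x + hbar *: l - 2^-1 *: (k *m theta))).
Proof.
rewrite /weyl_exp_star /star_theta.
(* Translating the wave of frequency [k'] by [hbar *: l] multiplies it by the constant
   [expi (hbar * dot k' l)]. *)
rewrite (_ : of_position (fun x' => expi (dot k' _)) =
    superpose (point_superposition (expi (hbar * dot k' l)) k' 0)); last first.
  apply/funext => y; apply/funext => q; rewrite superpose_point /of_position /wave.
  by rewrite dot0l addr0 -expiD dotDr dotZr addrC.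
rewrite (_ : of_position _ = fun y q => expi (hbar / 2 * dot k l) * wave k 0 y q).
  rewrite star_point_left superpose_point /wave !dot0l !addr0 !mul0r scale0r addr0.
  rewrite -!expiD; congr expi; rewrite !(dotDr, dotNr, dotZr); ring.
by apply/funext => y; apply/funext => q; rewrite /of_position /wave dot0l addr0 mulrC.
Qed.

Let Wphase (z : V * (V * V)) x : R :=
  dot z.1 x + hbar / 2 * dot z.1 z.2.1 +
  dot z.2.2 (x + hbar *: z.2.1 - 2^-1 *: (z.1 *m theta)).

(** [Wphase z x] is affine in [x] with slope [k + k']: its value at 0 enters the amplitude and the
    slope becomes the position frequency. *)
Let Wampl (z : V * (V * V)) : C :=
  alpha (z.1, z.2.1) * beta z.2.2 * expi (Wphase z 0).

Let mk : measurable_fun setT (fun z : V * (V * V) => z.1).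
Proof. exact: measurable_fst. Qed.
Let ml : measurable_fun setT (fun z : V * (V * V) => z.2.1).
Proof. exact: (measurableT_comp measurable_fst measurable_snd). Qed.
Let mk' : measurable_fun setT (fun z : V * (V * V) => z.2.2).
Proof. exact: (measurableT_comp measurable_snd measurable_snd). Qed.

Let mWphase x : measurable_fun setT (Wphase ^~ x).
Proof.
apply: measurable_funD.
  apply: measurable_funD; first exact: (measurable_dot mk (measurable_cst _)).
  by apply: measurable_funM => //; exact: (measurable_dot mk ml).
apply: (measurable_dot mk'); apply: measurable_rVB.
  by apply: measurable_rVD => //; exact: measurable_rVZ.
by apply: measurable_rVZ; exact: measurable_rV_mulmx.
Qed.

(** Kept general in [f] and [g] to serve both the normalised amplitudes and the bare Fourier
    transforms. *)
Let cintegrable_Wphase f g x : cintegrable (sprod leb leb) f -> cintegrable leb g ->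
  cintegrable (sprod leb (sprod leb leb))
    (fun z => f (z.1, z.2.1) * g z.2.2 * expi (Wphase z x)).
Proof.
move=> fi gi; apply: cintegrableM_expi; last exact: mWphase.
(* The integrand factors over [((k, l), k')], while the Weyl integral runs over [(k, (l, k'))]. *)
exact: (preserving_cintegrable (preserving_prodA leb leb leb)
  (cintegrable_sprodM fi gi)).
Qed.

Let mWx : measurable_fun setT (fun z : V * (V * V) => z.1 + z.2.2).
Proof. exact: (measurable_rVD mk mk'). Qed.

Definition weyl_superposition : superposition R n :=
  @Superposition R n _ _ (sprod leb (sprod leb leb)) Wampl _ (fun=> 0)
    (cintegrable_Wphase 0 alpha_integrable beta_integrable) mWx (measurable_cst (0 : V)).

Let weyl_starE0 x : weyl_star hbar theta A B x =
  cintegral (sprod leb (sprod leb leb))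
    (fun z => alpha (z.1, z.2.1) * beta z.2.2 * expi (Wphase z x)).
Proof.
have [_ Ai _] := A_proper; have [_ Bi _] := B_proper.
have fE : (fun z : V * (V * V) => let: (k, (l, k')) := z in
    fourier_xp A k l * fourier_x B k' *
    weyl_exp_star hbar theta k l (fun x' => expi (dot k' x')) x) =
  (fun z => fourier_xp A z.1 z.2.1 * fourier_x B z.2.2 * expi (Wphase z x)).
  by apply/funext => -[k [l k']]; rewrite weyl_exp_starE -expiD.
rewrite /weyl_star fE -cintegralZl; last exact: (cintegrable_Wphase x Ai Bi).
apply: eq_cintegral => z; rewrite /alpha /beta /=.
have -> : ((2 * pi) ^- (3 * n))%:C =
    ((2 * pi) ^- (2 * n))%:C * ((2 * pi) ^- n)%:C :> C.
  by rewrite -rmorphM/= -invfM -exprD -mulSnr.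
ring.
Qed.

Lemma superpose_weyl :
  superpose weyl_superposition = of_position (weyl_star hbar theta A B).
Proof.
apply/funext => x; apply/funext => p; rewrite /of_position weyl_starE0.
apply: eq_cintegral => z /=; rewrite /Wampl /wave dot0l addr0 -mulrA -expiD.
congr (_ * expi _); rewrite /Wphase !(dotDl, dotDr, dotNr, dot0r); ring.
Qed.

(** Integrating out [k'] rebuilds [B] from its Fourier representation, giving an integral over
    [(k, l)] comparable with [star_properE]. *)
Lemma weyl_starE x :
  let f z := alpha z * expi (dot z.1 x + hbar / 2 * dot z.1 z.2) *
    B (x + hbar *: z.2 - 2^-1 *: (z.1 *m theta)) in
  cintegrable (sprod leb leb) f /\
  weyl_star hbar theta A B x = cintegral (sprod leb leb) f.
Proof.
move=> f; pose g (s : (V * V) * V) := alpha s.1 * beta s.2 *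
  expi (Wphase (s.1.1, (s.1.2, s.2)) x).
have mg : cintegrable (sprod (sprod leb leb) leb) g.
  apply: cintegrableM_expi.
    exact: (cintegrable_sprodM alpha_integrable beta_integrable).
  apply: (measurableT_comp (mWphase x)).
  apply/measurable_fun_pair => /=; first exact: (measurableT_comp measurable_fst measurable_fst).
  apply/measurable_fun_pair => /=; last exact: measurable_snd.
  exact: (measurableT_comp measurable_snd measurable_fst).
have -> : weyl_star hbar theta A B x = cintegral (sprod (sprod leb leb) leb) g.
  rewrite weyl_starE0 -(preserving_cintegral (preserving_prodA leb leb leb) (cintegrable_measurable mg)).
  by apply: eq_cintegral => -[k [l k']].
suff <- : (fun z => cintegral leb (fun k' => g (z, k'))) = f by exact: cfubini.
apply/funext => z; rewrite /f proper_xE -cintegralZl.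
  by apply: eq_cintegral => k'; rewrite /g /Wphase expiD /= mulrACA.
by apply: cintegrableM_expi => //; exact: (measurable_dot (@measurable_id _ _ setT) (measurable_cst _)).
Qed.

Lemma wave0E y x p : wave 0 y x p = expi (dot y p) :> C.
Proof. by rewrite /wave dot0l add0r. Qed.

Lemma star_wave0 S y x p :
  star hbar theta (superpose S) (wave 0 y) x p =
  expi (dot y p) * superpose S (x - (hbar / 2) *: y) p.
Proof.
rewrite (_ : wave 0 y = fun x' p' => 1 * wave 0 y x' p'); last first.
  by apply/funext => x'; apply/funext => p'; rewrite mul1r.
by rewrite star_point_right mul1r wave0E mul0mx !scaler0 subr0 addr0.
Qed.

(** * Comparison of the two integrals over [y] *)

Hypothesis hbar0 : hbar != 0.
Variables (x p : V).

Let phiR (s : V * (V * V)) : R := dot s.1 p +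
  (dot s.2.1 (x - (hbar / 2) *: s.1) + hbar / 2 * dot s.2.1 s.2.2).

Let R_integrand (s : V * (V * V)) : C := alpha s.2 *
  B (x - (hbar / 2) *: s.1 + hbar *: s.2.2 - 2^-1 *: (s.2.1 *m theta)) *
  expi (phiR s).

(** Replacing [y] by [y + l] turns the argument shift [- hbar/2 y + hbar l] of [B] into
    [- hbar/2 y + hbar/2 l]. In the phase, [l.p] appears and the Weyl term [hbar/2 k.l] cancels. *)
Let shear (s : V * (V * V)) : V * (V * V) := (s.1 + s.2.2, s.2).

(** After a shear in [y] the argument of [B] no longer involves [(k, l)], and up to a phase the
    integrand is a product of integrable functions of [y] and of [(k, l)]. *)
Let R_integrable : cintegrable (sprod leb (sprod leb leb)) R_integrand.
Proof.
(* The solution of [- hbar/2 u = hbar l - k theta/2]. *)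
pose u (z : V * V) : V := - 2 *: z.2 + hbar^-1 *: (z.1 *m theta).
have mu : measurable_fun setT u.
  apply: measurable_rVD; apply: measurable_rVZ; first exact: measurable_snd.
  exact: (measurable_rV_mulmx theta measurable_fst).
have [Bi _ _] := B_proper.
(* A nonzero [hbar] makes [B (x - hbar/2 y)] integrable in [y]. *)
have a0 : - (hbar / 2) != 0 by rewrite oppr_eq0 mulf_neq0// invr_eq0 pnatr_eq0.
have := preserving_cintegrable (preserving_shear (sprod leb leb) mu)
  (cintegrable_sprodM (cintegrable_affine x a0 Bi) alpha_integrable).
move=> BAi; apply: cintegrableM_expi; last first.
  apply: measurable_funD; first exact: (measurable_dot mk (measurable_cst _)).
  apply: measurable_funD.
    apply: (measurable_dot ml); apply: measurable_rVB; first exact: measurable_cst.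
    exact: measurable_rVZ.
  by apply: measurable_funM => //; exact: (measurable_dot ml mk').
rewrite (_ : (fun s => _) = (fun s : V * (V * V) =>
  B (- (hbar / 2) *: (s.1 + u s.2) + x) * alpha s.2))//.
apply/funext => -[y [k l]] /=; rewrite mulrC; congr (B _ * _).
by apply/rowP => i; rewrite /u !mxE; field.
Qed.

Let rhs y :=
  star hbar theta (of_position (weyl_star hbar theta A B)) (wave 0 y) x p.
Let lhs y :=
  star hbar theta (star hbar theta A (of_position B)) (wave 0 y) x p.

Let rhsE : rhs = fun y => cintegral (sprod leb leb) (fun z => R_integrand (y, z)).
Proof.
apply/funext => y; rewrite /rhs -superpose_weyl star_wave0 superpose_weyl /of_position.
have [fi ->] := weyl_starE (x - (hbar / 2) *: y); rewrite -cintegralZl//.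
by apply: eq_cintegral => z; rewrite /R_integrand /phiR [in RHS]expiD /=; ring.
Qed.

Let lhsE : lhs = fun y => cintegral (sprod leb leb) (fun z => R_integrand (shear (y, z))).
Proof.
apply/funext => y; rewrite /lhs -superpose_star_proper star_wave0 superpose_star_proper.
have [fi ->] := star_properE (x - (hbar / 2) *: y) p; rewrite -cintegralZl//.
apply: eq_cintegral => z; rewrite /R_integrand /=.
rewrite mulrA mulrCA -expiD [RHS]mulrAC; congr (_ * _ * _); last first.
  by congr (B _); apply/rowP => i; rewrite !mxE; field.
by congr (expi _); rewrite /phiR /= !(dotDl, dotDr, dotNr, dotZr); field.
Qed.

Let shearP : preserving (sprod leb (sprod leb leb)) (sprod leb (sprod leb leb)) shear.
Proof. exact: (preserving_shear (sprod leb leb) measurable_snd). Qed.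

(** Fubini, with [y] outermost, applies to [R_integrand] and to its composite with [shear];
    invariance under [shear] equates the two total integrals. *)
Lemma integral_star_wave :
  [/\ cintegrable leb lhs, cintegrable leb rhs & cintegral leb lhs = cintegral leb rhs].
Proof.
have [rhs_int rhs_integral] := cfubini R_integrable.
have [lhs_int lhs_integral] := cfubini (preserving_cintegrable shearP R_integrable).
rewrite lhsE rhsE; split; [exact: lhs_int|exact: rhs_int|].
apply: etrans (esym lhs_integral) (etrans _ rhs_integral).
exact: (preserving_cintegral shearP (cintegrable_measurable R_integrable)).
Qed.

End proper_functions.

Theorem theorem1 (R : realType) (n : nat) (n_ge1 : (1 <= n)%N)
    (hbar : R) (hbar_gt0 : 0 < hbar)
    (theta : 'M[R]_n) (theta_antisym : theta^T = - theta)
    (A : 'rV[R]_n -> 'rV[R]_n -> R[i]) (B : 'rV[R]_n -> R[i])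
    (A_proper : proper_xp A) (B_proper : proper_x B) (x p : 'rV[R]_n) :
  let lhs (y : 'rV[R]_n) :=
    star hbar theta (star hbar theta A (of_position B)) (wave 0 y) x p in
  let rhs (y : 'rV[R]_n) :=
    star hbar theta (of_position (weyl_star hbar theta A B)) (wave 0 y) x p in
  [/\ cintegrable (lebesgue_rV n) lhs, cintegrable (lebesgue_rV n) rhs &
      cintegral (lebesgue_rV n) lhs = cintegral (lebesgue_rV n) rhs].
Proof.
exact: (integral_star_wave theta A_proper B_proper (lt0r_neq0 hbar_gt0) x p).
Qed.
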